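(* Let $b_{1}$ and $b_{2}$ be separable bipotentials associated respectively to the convex and lower semicontinuous functions $\phi_{1}, \phi_{2}: X \rightarrow \bar{\mathbb{R}}$, that is, $b_{i}(x,y) = \phi_{i}(x) + \phi_{i}^{*}(y)$ for any $i=1,2$ and $(x,y) \in X \times Y$. Consider the following assertions: (i) $b = \max(b_{1}, b_{2})$ is a strong bipotential. (ii') For any $y \in \mathrm{dom}\, \phi_{1}^{*} \cap \mathrm{dom}\, \phi_{2}^{*}$ and for any $\lambda \in [0,1]$ we have $$\left( \lambda \phi_{1} + (1-\lambda) \phi_{2} \right)^{*}(y) = \lambda \phi_{1}^{*}(y) + (1-\lambda) \phi_{2}^{*}(y).$$ (ii'') For any $x \in \mathrm{dom}\, \phi_{1} \cap \mathrm{dom}\, \phi_{2}$ and for any $\lambda \in [0,1]$ we have $$\left( \lambda \phi_{1}^{*} + (1-\lambda) \phi_{2}^{*} \right)^{*}(x) = \lambda \phi_{1}(x) + (1-\lambda) \phi_{2}(x).$$ Then (i) is equivalent to the conjunction of (ii') and (ii'').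
   Context: $X$ and $Y$ are topological, locally convex, real vector spaces in duality via a duality product $\langle \cdot,\cdot\rangle : X \times Y \to \mathbb{R}$, with topologies compatible with the duality product: any continuous linear functional on $X$ has the form $x \mapsto \langle x,y\rangle$ for some $y \in Y$, and any continuous linear functional on $Y$ has the form $y \mapsto \langle x,y \rangle$ for some $x \in X$. $\bar{\mathbb{R}} = \mathbb{R} \cup \{+\infty\}$. For a function $\phi$ on $X$, its conjugate is the function on $Y$ given by $\phi^{*}(y) = \sup\{ \langle x, y\rangle - \phi(x) \mid x \in X\}$; similarly, for a function $\psi$ on $Y$, its conjugate is the function on $X$ given by $\psi^{*}(x) = \sup\{\langle x,y\rangle - \psi(y) \mid y \in Y\}$. The effective domain $\mathrm{dom}\,\phi$ of a function is the set of points where $\phi < +\infty$. The separable bipotential associated to a convex lower semicontinuous function $\phi: X \to \bar{\mathbb{R}}$ is the function $b: X \times Y \to \bar{\mathbb{R}}$, $b(x,y) = \phi(x) + \phi^{*}(y)$. A function $b: X \times Y \to \bar{\mathbb{R}}$ is a strong bipotential if: (a) $b$ is convex and lower semicontinuous in each argument; (B1S) for any $y \in Y$, $\inf\{ b(z,y) - \langle z,y\rangle : z \in X\} \in \{0,+\infty\}$; (B2S) for any $x \in X$, $\inf\{ b(x,p) - \langle x,p\rangle : p \in Y\} \in \{0,+\infty\}$.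
   Formalization: Added: the conjugates on the left of (ii') and (ii'') are not −∞ at the points considered. Otherwise false: for the indicators of {0} and {1} on the real line, b is identically +∞, so (i) holds but (ii') fails at λ=1/2. *)

(* Defs.v *)
From HB Require Import structures.
From mathcomp Require Import all_boot all_order all_algebra.
From mathcomp Require Import sesquilinear.
From mathcomp Require Import all_classical all_reals all_analysis.

Set Implicit Arguments.
Unset Strict Implicit.
Unset Printing Implicit Defensive.

Import Order.TTheory GRing.Theory Num.Theory.
Import numFieldNormedType.Exports.

Local Open Scope classical_set_scope.
Local Open Scope ring_scope.
Local Open Scope ereal_scope.

(* A topology is compatible with the duality when its continuous linear
   functionals are exactly the pairings with the elements of the other space. *)
Definition compatible_duality (R : realType) (X Y : tvsType R)
    (p : X -> Y -> R^o) : Prop :=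
  (forall f : {linear X -> R^o},
      continuous f <-> exists y : Y, forall x, f x = p x y) /\
  (forall g : {linear Y -> R^o},
      continuous g <-> exists x : X, forall y, g y = p x y).

(* Functions into `R \cup {+oo}` are functions into `\bar R` that avoid `-oo`. *)
Definition Rpinfty_valued (R : realType) (T : Type) (f : T -> \bar R) : Prop :=
  forall x, f x != -oo.

Definition dom (R : realType) (T : Type) (f : T -> \bar R) : set T :=
  [set x | f x < +oo].

(* In `\bar R`, `0 * +oo = 0`, the usual convention of convex analysis. *)
Definition conv_comb (R : realType) (T : Type) (l : R) (f g : T -> \bar R) :
    T -> \bar R :=
  fun x => l%:E * f x + (1 - l)%:E * g x.

(* Meant for functions that avoid `-oo`. *)
Definition econvex (R : realType) (E : lmodType R) (f : E -> \bar R) : Prop :=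
  forall (x y : E) (t : R), (0 <= t <= 1)%R ->
    f (t *: x + (1 - t) *: y)%R <= t%:E * f x + (1 - t)%:E * f y.

(* The supremum is taken in `\bar R`; it is `-oo` when `f` is identically
   `+oo`. *)
Definition conjugate (R : realType) (X Y : Type) (p : X -> Y -> R)
    (f : X -> \bar R) : Y -> \bar R :=
  fun y => ereal_sup [set (p x y)%:E - f x | x in [set: X]].

(* The conjugate, on X, of a function on Y. *)
Definition conjugate' (R : realType) (X Y : Type) (p : X -> Y -> R)
    (g : Y -> \bar R) : X -> \bar R :=
  conjugate (fun y x => p x y) g.

(* Since `b` has to take its values in `R \cup {+oo}`, so does the conjugate of
   `phi`; this excludes exactly the function `phi` identically `+oo`. *)
Record separable_bipotential (R : realType) (X Y : tvsType R)
    (p : X -> Y -> R) (phi : X -> \bar R) (b : X -> Y -> \bar R) : Prop := {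
  sepb_valued : Rpinfty_valued phi;
  sepb_conj_valued : Rpinfty_valued (conjugate p phi);
  sepb_convex : econvex phi;
  sepb_lsc : lower_semicontinuous phi;
  sepb_def : forall x y, b x y = phi x + conjugate p phi y
}.

Record strong_bipotential (R : realType) (X Y : tvsType R)
    (p : X -> Y -> R) (b : X -> Y -> \bar R) : Prop := {
  sb_valued : forall x y, b x y != -oo;
  sb_convexl : forall y, econvex (b ^~ y);
  sb_convexr : forall x, econvex (b x);
  sb_lscl : forall y, lower_semicontinuous (b ^~ y);
  sb_lscr : forall x, lower_semicontinuous (b x);
  sb_B1S : forall y,
    [set 0; +oo] (ereal_inf [set b z y - (p z y)%:E | z in [set: X]]);
  sb_B2S : forall x,
    [set 0; +oo] (ereal_inf [set b x q - (p x q)%:E | q in [set: Y]])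
}.

(* Main.v *)
Require Import Defs.
From HB Require Import structures.
From mathcomp Require Import all_boot all_order all_algebra.
From mathcomp Require Import sesquilinear.
From mathcomp Require Import lra.
From mathcomp Require Import all_classical all_reals all_analysis.

Set Implicit Arguments.
Unset Strict Implicit.
Unset Printing Implicit Defensive.

Import Order.TTheory GRing.Theory Num.Theory.
Import numFieldNormedType.Exports.

Local Open Scope classical_set_scope.
Local Open Scope ring_scope.
Local Open Scope ereal_scope.


(** Fix [y] where both conjugates are finite and put
    [F_i z = phi_i z + phi_i^* y - <z, y>].  By the Young-Fenchel inequality
    [F_i >= 0], and the definition of the conjugate gives
    [inf (l F_1 + (1 - l) F_2)
       = l phi_1^* y + (1 - l) phi_2^* y - (l phi_1 + (1 - l) phi_2)^* y],
    so the identity at [(y, l)] says that this infimum vanishes.  On the other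
    hand the condition B1S at [y] says that [inf (max (F_1, F_2))] is [0] or
    [+oo].  The two are linked by two elementary facts:
    - a convex combination is at most the maximum, so [inf max = 0] gives the
      identity for every [l];
    - if two nonnegative numbers have a small mean, both are small, so the
      identity at [l = 1/2] alone already gives [inf max = 0].
    The value [+oo] of [inf max] means that [phi_1] and [phi_2] are never
    finite together; then the conjugate of their mean is [-oo], which is
    precisely what the hypothesis on its values forbids.  If one of the
    conjugates is [+oo] at [y], the maximum is identically [+oo] and B1S holds.

    The same argument with the roles of [X] and [Y] exchanged, the functions
    being [phi_i^*] and the constants [phi_i x], links B2S with the second
    family of identities, since the Young-Fenchel inequality reads the same
    from both sides.  Both cases are [inf_max_iff_conjugate_comb].

    Convexity and lower semicontinuity of the maximum in each variable hold in
    any case, since [phi_i] and its conjugate have these properties and they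
    survive the addition of a constant and the passage to a maximum. *)

(** * Stability of convexity and lower semicontinuity *)

Lemma lower_semicontinuous_max (R : realType) (T : topologicalType)
    (f g : T -> \bar R) :
  lower_semicontinuous f -> lower_semicontinuous g ->
  lower_semicontinuous (fun x => maxe (f x) (g x)).
Proof.
move=> lf lg x a; rewrite lt_max => /orP[/lf|/lg] [V nV Va];
  exists V => // z Vz.
- by rewrite lt_max Va.
- by rewrite lt_max Va// orbT.
Qed.

Lemma lower_semicontinuous_addr (R : realType) (T : topologicalType)
    (f : T -> \bar R) (c : \bar R) :
  Rpinfty_valued f -> c != -oo -> lower_semicontinuous f ->
  lower_semicontinuous (fun x => f x + c).
Proof.
move=> fN; case: c => [c||//] _ lf x a.
- rewrite -lteBlDr// -EFinB => /lf[V nV Va]; exists V => // z /Va.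
  by rewrite EFinB lteBlDr.
- move=> _; exists setT; first exact: filterT.
  by move=> z _; rewrite addey ?fN// ltry.
Qed.

Lemma econvex_max (R : realType) (E : lmodType R) (f g : E -> \bar R) :
  econvex f -> econvex g -> econvex (fun x => maxe (f x) (g x)).
Proof.
move=> cf cg x y t t01; have /andP[t0 t1] := t01.
have mono (a b c d : \bar R) : a <= c -> b <= d ->
    t%:E * a + (1 - t)%:E * b <= t%:E * c + (1 - t)%:E * d.
  by move=> ac bd; apply: leeD; apply: lee_wpmul2l => //;
    rewrite lee_fin ?subr_ge0.
rewrite ge_max; apply/andP; split.
- by apply: (le_trans (cf _ _ _ t01)); apply: mono; rewrite le_max lexx.
- by apply: (le_trans (cg _ _ _ t01)); apply: mono; rewrite le_max lexx orbT.
Qed.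

Lemma econvex_addr (R : realType) (E : lmodType R) (f : E -> \bar R)
    (c : \bar R) :
  Rpinfty_valued f -> c != -oo -> econvex f -> econvex (fun x => f x + c).
Proof.
move=> fN cN cf x y t t01; have /andP[t0 t1] := t01.
have tF (u v : \bar R) : u != -oo -> v != -oo ->
    t%:E * (u + c) + (1 - t)%:E * (v + c)
    = t%:E * u + (1 - t)%:E * v + c.
  move=> uN vN.
  have defc (w : \bar R) : w != -oo -> w +? c.
    by case: w c cN {cf} => [?||] [?||].
  rewrite !muleDr ?defc// addeACA; congr (_ + _).
  by rewrite -ge0_muleDl ?lee_fin ?subr_ge0// -EFinD addrC subrK mul1e.
by rewrite tF ?fN//; apply: leeD => //; exact: cf.
Qed.

(** * Conjugate functions *)

Lemma Young_Fenchel (R : realType) (X Y : Type) (p : X -> Y -> R)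
    (f : X -> \bar R) (x : X) (y : Y) :
  f x != -oo -> conjugate p f y != -oo ->
  (p x y)%:E <= f x + conjugate p f y.
Proof.
have : (p x y)%:E - f x <= conjugate p f y by apply: ereal_sup_ubound; exists x.
case: (f x) => [r||//]; first by rewrite leeBlDl.
by move=> _ _ cN; rewrite addye// leey.
Qed.

(** A supremum of functions [y |-> <x, y> - f x], each of them continuous or an
    infinite constant. *)
Lemma lower_semicontinuous_conjugate (R : realType) (X : Type)
    (Y : topologicalType) (p : X -> Y -> R^o) (f : X -> \bar R) :
  (forall x, continuous (p x)) ->
  lower_semicontinuous (conjugate (p : X -> Y -> R) f).
Proof.
move=> pc y a /ereal_sup_gt[_ [x _ <-]] apf.
suff [V nV Va] : exists2 V : set Y, nbhs y V &
    forall z, V z -> a%:E < (p x z)%:E - f x.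
  exists V => // z /Va az; apply: (lt_le_trans az).
  by apply: ereal_sup_ubound; exists x.
case: (f x) apf => [r|//|] /=.
- rewrite -EFinB lte_fin ltrBrDr => apr.
  exists [set z | (a + r < p x z)%R].
    by apply: (cvgr_gt (p x y)) => //; exact: pc.
  by move=> z /= az; rewrite -EFinB lte_fin ltrBrDr.
- by move=> _; exists setT => [|z _]; [exact: filterT|rewrite ltry].
Qed.

(** A supremum of affine functions and of constants [-oo], the latter coming
    from the points where [f] is [+oo]. *)
Lemma econvex_conjugate (R : realType) (X : Type) (Y : lmodType R)
    (p : X -> {linear Y -> R^o}) (f : X -> \bar R) :
  Rpinfty_valued f -> econvex (conjugate (fun x y => p x y : R) f).
Proof.
move=> fN y z t /andP[t0 t1]; apply: ge_ereal_sup => _ [x _ <-].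
set q := fun (x : X) (y : Y) => (p x y : R).
have le w : (p x w)%:E - f x <= conjugate q f w.
  by apply: ereal_sup_ubound; exists x.
move: (le y) (le z) (fN x); case: (f x) => [r|_ _ _|//]; last by rewrite leNye.
move=> ley lez _.
apply: (@le_trans _ _ (t%:E * ((p x y)%:E - r%:E)
                       + (1 - t)%:E * ((p x z)%:E - r%:E))).
  rewrite linearD !linearZ /= -!EFinB -!EFinM -EFinD lee_fin /GRing.scale /=.
  by lra.
by apply: leeD; apply: lee_wpmul2l => //; rewrite lee_fin ?subr_ge0.
Qed.


(** * The maximum and the convex combinations of two nonnegative functions *)

(** The convex combination of two Young-Fenchel inequalities.  The endpoints
    [l = 0, 1] are apart because [0 * +oo = 0] makes an infinite [u] or [v]
    invisible there, whereas for [0 < l < 1] an infinite [u] or [v] makes the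
    left side [-oo]. *)
Lemma sup_comb_le (R : realType) (l h c d : R) (u v : \bar R) :
  (0 <= l <= 1)%R -> u != -oo -> v != -oo ->
  h%:E <= u + c%:E -> h%:E <= v + d%:E ->
  h%:E - (l%:E * u + (1 - l)%:E * v) <= l%:E * c%:E + (1 - l)%:E * d%:E.
Proof.
move=> /andP[l0 l1] uN vN hu hv.
have [->|ln0] := eqVneq l 0%R.
  rewrite !mul0e !add0e subr0 !mul1e.
  by move: v vN hv => [v||] //= _;
    rewrite -?EFinD -?EFinB ?leNye// !lee_fin; lra.
have [->|ln1] := eqVneq l 1%R.
  rewrite subrr !mul0e !adde0 !mul1e.
  by move: u uN hu => [u||] //= _;
    rewrite -?EFinD -?EFinB ?leNye// !lee_fin; lra.
have lp : (0 < l)%R by rewrite lt_neqAle eq_sym ln0.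
have lp' : (0 < 1 - l)%R by rewrite subr_gt0 lt_neqAle ln1.
move: u v uN vN hu hv => [u||//] [v||//] _ _ hu hv;
  rewrite ?(gt0_muley, gt0_mulye) ?lte_fin//= ?leNye//.
by move: hu hv; rewrite -!EFinM -!EFinD !lee_fin; nra.
Qed.

(** A convex combination of [u + c - h] and [v + d - h] is at most their
    maximum. *)
Lemma comb_ge_of_max_lt (R : realType) (l h c d e : R) (u v : \bar R) :
  (0 <= l <= 1)%R -> u != -oo -> v != -oo ->
  maxe (u + c%:E) (v + d%:E) - h%:E < e%:E ->
  l%:E * c%:E + (1 - l)%:E * d%:E - e%:E
    <= h%:E - (l%:E * u + (1 - l)%:E * v).
Proof.
move=> /andP[l0 l1] uN vN; rewrite lteBlDr// gt_max => /andP[].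
move: u v uN vN => [u||//] [v||//] _ _ //.
rewrite -!EFinM -!EFinD !lte_fin !lee_fin => ue ve.
by nra.
Qed.

(** Two nonnegative numbers whose mean is less than [e / 2] are both less than
    [e]. *)
Lemma max_lt_of_half_gt (R : realType) (h c d e : R) (u v : \bar R) :
  u != -oo -> v != -oo -> h%:E <= u + c%:E -> h%:E <= v + d%:E ->
  (2^-1)%:E * c%:E + (1 - 2^-1)%:E * d%:E - (e / 2)%:E
    < h%:E - ((2^-1)%:E * u + (1 - 2^-1)%:E * v) ->
  maxe (u + c%:E) (v + d%:E) - h%:E < e%:E.
Proof.
have h0 : (0 < 2^-1 :> R)%R by rewrite invr_gt0.
have h1 : (0 < 1 - 2^-1 :> R)%R by lra.
move=> uN vN hu hv huv; rewrite lteBlDr// gt_max.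
move: u v uN vN hu hv huv => [u||//] [v||//] _ _;
  rewrite ?(gt0_muley, gt0_mulye) ?lte_fin//= ?[_ < -oo]ltNge ?leNye//.
rewrite -!EFinD !lee_fin => hu hv huv.
by apply/andP; split; lra.
Qed.

(** The equivalence at a single point, for one variable.  The pairing with the
    fixed point is the function [h], and the constants [c] and [d] are only
    required to satisfy the Young-Fenchel inequality, so that they can be the
    values of the conjugates of [f] and [g] as well as those of functions of
    which [f] and [g] are the conjugates. *)
Lemma inf_max_iff_conjugate_comb (R : realType) (T : Type) (h : T -> R)
    (f g : T -> \bar R) (c d : \bar R) :
  Rpinfty_valued f -> Rpinfty_valued g -> c != -oo -> d != -oo ->
  (forall z, (h z)%:E <= f z + c) -> (forall z, (h z)%:E <= g z + d) ->
  let conj l := ereal_sup [set (h z)%:E - conv_comb l f g z | z in [set: T]] in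
  (c < +oo -> d < +oo -> forall l : R, (0 <= l <= 1)%R -> conj l != -oo) ->
  [set 0; +oo] (ereal_inf
    [set maxe (f z + c) (g z + d) - (h z)%:E | z in [set: T]]) <->
  (c < +oo -> d < +oo -> forall l : R, (0 <= l <= 1)%R ->
     conj l = l%:E * c + (1 - l)%:E * d).
Proof.
move=> fN gN cN dN fc gd conj conjN; set m := ereal_inf _.
have half01 : (0 <= (2^-1 : R) <= 1)%R by rewrite invr_ge0 ler0n/=; lra.
case: c cN fc conjN @m => [c|_ fc _ m|//]; last first.
  split=> // _; right; apply/ereal_inf_pinfty => _ [z _ <-] /=.
  by rewrite addey ?fN// maxye addye.
case: d dN gd => [d|_ gd _ fc _ m|//]; last first.
  split=> // _; right; apply/ereal_inf_pinfty => _ [z _ <-] /=.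
  by rewrite addey ?gN// maxey addye.
move=> _ gd _ fc /(_ (ltry _) (ltry _)) conjN m; split.
- move=> m0 _ _ l l01.
  (* An infinite infimum would leave no point where f and g are both finite. *)
  have mfin : m = 0.
    case: m0 => // my; have := conjN _ half01; case/negP; apply/eqP.
    apply/ereal_sup_ninfty => _ [z _ <-] /=.
    have /ereal_inf_pinfty/(_ _ (ex_intro2 _ _ z I erefl)) := my.
    rewrite /conv_comb; have := fN z; have := gN z.
    have h1 : (0 < 1 - 2^-1 :> R)%R by lra.
    case: (f z) (g z) => [u||//] [v||//] _ _ /=;
      rewrite ?(gt0_muley, gt0_mulye) ?lte_fin ?invr_gt0//=.
    by rewrite maxEle; case: ifP.
  apply/eqP; rewrite eq_le; apply/andP; split.
    by apply: ge_ereal_sup => _ [z _ <-]; exact: sup_comb_le.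
  apply/lee_subgt0Pr => e e0.
  have /ereal_inf_lt[_ [z _ <-] ze] : m < e%:E by rewrite mfin lte_fin.
  apply: (le_trans (comb_ge_of_max_lt l01 (fN z) (gN z) ze)).
  by apply: ereal_sup_ubound; exists z.
- move=> /(_ (ltry _) (ltry _) _ half01) conjE; left.
  apply/eqP; rewrite eq_le; apply/andP; split.
    apply/lee_addgt0Pr => e e0; rewrite add0e.
    have /ereal_sup_gt[_ [z _ <-] /(max_lt_of_half_gt (fN z) (gN z)) ze] :
        (2^-1)%:E * c%:E + (1 - 2^-1)%:E * d%:E - (e / 2)%:E < conj (2^-1)%R.
      by rewrite conjE /= lte_fin ltrBlDr ltrDl divr_gt0.
    apply: le_trans (ltW (ze (fc z) (gd z))).
    by apply: ereal_inf_lbound; exists z.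
  apply: le_ereal_inf_tmp => _ [z _ <-].
  by rewrite leeBrDr// add0e le_max fc.
Qed.

(* The hypotheses `hconjY` and `hconjX` say that the conjugates on the left-hand
   sides of the two identities take their values in `R \cup {+oo}`. Without them
   the equivalence fails: on the real line, take for phi1 and phi2 the indicator
   functions of {0} and {1}; then max(b1, b2) is identically +oo, while the
   left-hand side of the first identity is -oo for 0 < l < 1. *)
Theorem theorem3p1 (R : realType) (X Y : tvsType R)
    (p : {bilinear X -> Y -> R^o | *:%R & *:%R})
    (hp : compatible_duality p)
    (phi1 phi2 : X -> \bar R) (b1 b2 : X -> Y -> \bar R)
    (hb1 : separable_bipotential p phi1 b1)
    (hb2 : separable_bipotential p phi2 b2)
    (hconjY : forall (y : Y) (l : R),
       dom (conjugate p phi1) y -> dom (conjugate p phi2) y ->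
       (0 <= l <= 1)%R -> conjugate p (conv_comb l phi1 phi2) y != -oo)
    (hconjX : forall (x : X) (l : R),
       dom phi1 x -> dom phi2 x -> (0 <= l <= 1)%R ->
       conjugate' p (conv_comb l (conjugate p phi1) (conjugate p phi2)) x
         != -oo) :
  strong_bipotential p (fun x y => maxe (b1 x y) (b2 x y)) <->
  (forall (y : Y) (l : R),
     (dom (conjugate p phi1) `&` dom (conjugate p phi2)) y ->
     (0 <= l <= 1)%R ->
     conjugate p (conv_comb l phi1 phi2) y =
       l%:E * conjugate p phi1 y + (1 - l)%:E * conjugate p phi2 y) /\
  (forall (x : X) (l : R),
     (dom phi1 `&` dom phi2) x ->
     (0 <= l <= 1)%R ->
     conjugate' p (conv_comb l (conjugate p phi1) (conjugate p phi2)) x =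
       l%:E * phi1 x + (1 - l)%:E * phi2 x).
Proof.
have [phi1N conj1N cvx1 lsc1 b1E] := hb1.
have [phi2N conj2N cvx2 lsc2 b2E] := hb2.
have pc x : continuous (p x) by apply/(hp.2 (p x)); exists x.
have B1 y : [set 0; +oo] (ereal_inf
    [set maxe (b1 z y) (b2 z y) - (p z y)%:E | z in [set: X]]) <->
    (conjugate p phi1 y < +oo -> conjugate p phi2 y < +oo ->
     forall l : R, (0 <= l <= 1)%R ->
     conjugate p (conv_comb l phi1 phi2) y =
       l%:E * conjugate p phi1 y + (1 - l)%:E * conjugate p phi2 y).
  under eq_imagel do rewrite b1E b2E.
  apply: inf_max_iff_conjugate_comb => //.
  - by move=> x; exact: Young_Fenchel.
  - by move=> x; exact: Young_Fenchel.
  - by move=> h1 h2 l; exact: hconjY.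
have B2 x : [set 0; +oo] (ereal_inf
    [set maxe (b1 x q) (b2 x q) - (p x q)%:E | q in [set: Y]]) <->
    (phi1 x < +oo -> phi2 x < +oo -> forall l : R, (0 <= l <= 1)%R ->
     conjugate' p (conv_comb l (conjugate p phi1) (conjugate p phi2)) x =
       l%:E * phi1 x + (1 - l)%:E * phi2 x).
  under eq_imagel do rewrite b1E b2E [phi1 x + _]addeC [phi2 x + _]addeC.
  apply: inf_max_iff_conjugate_comb => //.
  - by move=> y; rewrite addeC; exact: Young_Fenchel.
  - by move=> y; rewrite addeC; exact: Young_Fenchel.
  - by move=> h1 h2 l; exact: hconjX.
split=> [[_ _ _ _ _ B1S B2S]|[iiY iiX]].
  split=> [y l [d1 d2] l01|x l [d1 d2] l01].
  - exact: (B1 y).1.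
  - exact: (B2 x).1.
have b1y y : b1 ^~ y = fun x => phi1 x + conjugate p phi1 y.
  by apply/funext => x.
have b2y y : b2 ^~ y = fun x => phi2 x + conjugate p phi2 y.
  by apply/funext => x.
have b1x x : b1 x = fun y => conjugate p phi1 y + phi1 x.
  by apply/funext => y; rewrite addeC.
have b2x x : b2 x = fun y => conjugate p phi2 y + phi2 x.
  by apply/funext => y; rewrite addeC.
split.
- move=> x y; rewrite b1E b2E.
  have finN (a b : \bar R) : a != -oo -> b != -oo -> a + b != -oo.
    by case: a b => [?||] [?||].
  by rewrite maxEle; case: ifP => _; exact: finN.
- move=> y; apply: econvex_max; rewrite ?b1y ?b2y; exact: econvex_addr.
- move=> x; apply: econvex_max; rewrite ?b1x ?b2x; apply: econvex_addr => //;
  exact: econvex_conjugate.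
- by move=> y; apply: lower_semicontinuous_max; rewrite ?b1y ?b2y;
    apply: lower_semicontinuous_addr.
- move=> x; apply: lower_semicontinuous_max; rewrite ?b1x ?b2x;
    apply: lower_semicontinuous_addr => //;
    exact: lower_semicontinuous_conjugate.
- by move=> y; apply/(B1 y) => d1 d2 l; exact: iiY.
- by move=> x; apply/(B2 x) => d1 d2 l; exact: iiX.
Qed.
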